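(* Let $\sigma\in SO(3)$. Then for all $q\in\mathbb{H}_{\mathbb R}$ with $\mathrm{Sc}(q)>1$ and all $t\in\mathbb{R}$, $$B_{(1\otimes\sigma)(q)}(t)=(1\otimes\sigma)(B_q(t)).$$
   Context: $\mathbb{H}_{\mathbb R}$ is the real quaternion algebra with basis $1,e_1,e_2,e_3$, and $\mathbb{H}_{\mathbb C}$ its complexification (the complex unit $i$ commutes with $e_1,e_2,e_3$). $q=a+v$ with scalar part $a=\mathrm{Sc}(q)$ and vector part $v=\sum_{j=1}^3v_je_j$, identified with $(v_1,v_2,v_3)\in\mathbb{R}^3$. For $\sigma\in SO(3)$, $(1\otimes\sigma)(a+v):=a+\sigma v$ (extended complex-linearly to $\mathbb{H}_{\mathbb C}$). For $z\in\mathbb{C}$, $z^q:=z^a[\cos(|v|\log z)+\frac{v}{|v|}\sin(|v|\log z)]\in\mathbb{H}_{\mathbb C}$ (principal branch; second term $0$ if $v=0$; $0^q:=0$ if $a>0$). For $\mathrm{Sc}(q)>1$ the quaternionic B-spline $B_q$ is the (continuous) function with Fourier transform $\widehat{B_q}(\xi)=\left(\frac{1-e^{-i\xi}}{i\xi}\right)^q$ (base equal to $1$ at $\xi=0$), where $\widehat f(\xi)=\int_{\mathbb R}f(x)e^{-i\xi x}dx$. *)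

(* Defs.v *)
From HB Require Import structures.
From mathcomp Require Import all_boot all_order all_algebra.
From mathcomp Require Import all_classical all_reals all_analysis.
From mathcomp Require Import complex.

Set Implicit Arguments.
Unset Strict Implicit.
Unset Printing Implicit Defensive.

Import Order.TTheory GRing.Theory Num.Theory.
Import numFieldNormedType.Exports.

Local Open Scope classical_set_scope.
Local Open Scope ring_scope.
Local Open Scope complex_scope.

(* Quaternions a + v over a field K: [quat R] is H_R, and [quat R[i]] is its
   complexification H_C. Vector parts are column vectors of coordinates in the
   basis e_1, e_2, e_3. Only the K-linear structure is needed below, so the
   Hamilton product is not introduced. *)
Definition quat (K : Type) : Type := (K * 'cV[K]_3)%type.

Definition Sc (K : Type) (q : quat K) : K := q.1.
Definition Vec (K : Type) (q : quat K) : 'cV[K]_3 := q.2.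

Definition qscale (K : comNzRingType) (c : K) (q : quat K) : quat K :=
  (c * Sc q, c *: Vec q).

Definition SO3 (R : realType) : set 'M[R]_3 :=
  [set s | s^T *m s = 1%:M /\ \det s = 1].

(* 1 (x) s, over any coefficient ring. *)
Definition qrot (K : comNzRingType) (s : 'M[K]_3) (q : quat K) : quat K :=
  (Sc q, s *m Vec q).

(* The complex-linear extension of 1 (x) s to H_C. *)
Definition qrotC (R : realType) (s : 'M[R]_3) : quat R[i] -> quat R[i] :=
  qrot (map_mx (real_complex R) s).

(* The Euclidean norm; the library norm on matrices is the sup norm. *)
Definition vnorm (R : realType) (v : 'cV[R]_3) : R :=
  Num.sqrt (\sum_(j < 3) v j ord0 ^+ 2).

Section ComplexFunctions.
Variable R : realType.
Implicit Types z w : R[i].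

Definition cexp z : R[i] :=
  (expR (complex.Re z))%:C
  * (cos (complex.Im z) +i* sin (complex.Im z)).

Definition ccos z : R[i] := (cexp ('i%C * z) + cexp (- ('i%C * z))) / 2%:R.

Definition csin z : R[i] :=
  (cexp ('i%C * z) - cexp (- ('i%C * z))) / (2%:R * 'i%C).

Definition cmod z : R :=
  Num.sqrt (complex.Re z ^+ 2 + complex.Im z ^+ 2).

(* The principal argument, in ]-pi, pi]; meaningful for z != 0. *)
Definition carg z : R :=
  let t := acos (complex.Re z / cmod z) in
  if 0 <= complex.Im z then t else - t.

(* The principal branch of the logarithm; meaningful for z != 0. *)
Definition clog z : R[i] := ln (cmod z) +i* carg z.

(* z^q. The second summand vanishes when v = 0. The value 0 at z = 0 is the
   intended one when Sc q > 0, and is a dummy value otherwise. *)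
Definition qpow z (q : quat R) : quat R[i] :=
  let a := Sc q in
  let v := Vec q in
  if z == 0 then (0, 0) else
  qscale (cexp (a%:C * clog z))
    (ccos ((vnorm v)%:C * clog z),
     csin ((vnorm v)%:C * clog z)
       *: map_mx (real_complex R) ((vnorm v)^-1 *: v)).

End ComplexFunctions.

Section Fourier.
Variable R : realType.
Local Notation mu := (@lebesgue_measure R).
Implicit Types (g : R -> R[i]) (f : R -> quat R[i]).

(* P holds of each of the eight real coordinate functions of f. *)
Definition coordwise (P : (R -> R) -> Prop) f : Prop :=
  [/\ P (fun x => complex.Re (Sc (f x))),
      P (fun x => complex.Im (Sc (f x))),
      forall j, P (fun x => complex.Re (Vec (f x) j ord0)) &
      forall j, P (fun x => complex.Im (Vec (f x) j ord0))].

Definition qcontinuous f : Prop := coordwise (fun h => continuous h) f.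

Definition qintegrable f : Prop :=
  coordwise (fun h => mu.-integrable setT (EFin \o h)) f.

Definition cintegral g : R[i] :=
  Rintegral mu setT (fun x => complex.Re (g x))
  +i* Rintegral mu setT (fun x => complex.Im (g x)).

Definition qintegral f : quat R[i] :=
  (cintegral (fun x => Sc (f x)),
   \col_j cintegral (fun x => Vec (f x) j ord0)).

Definition fourier f (xi : R) : quat R[i] :=
  qintegral (fun x => qscale (cexp (- ('i%C * xi%:C * x%:C))) (f x)).

Definition Bspline_base (xi : R) : R[i] :=
  if xi == 0 then 1 else (1 - cexp (- ('i%C * xi%:C))) / ('i%C * xi%:C).

Definition is_Bspline (q : quat R) f : Prop :=
  [/\ qcontinuous f, qintegrable f &
      forall xi, fourier f xi = qpow (Bspline_base xi) q].

(* B_q: the function singled out by [is_Bspline q]. Such a function exists and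
   is unique when Sc q > 1; the zero function is a dummy default. *)
Definition Bspline (q : quat R) : R -> quat R[i] :=
  xget (fun=> (0, 0)) [set f | is_Bspline q f].

End Fourier.

(* Main.v *)
Require Import Defs.
From mathcomp Require Import all_boot all_order all_algebra.
From mathcomp Require Import all_classical all_reals all_analysis.
From mathcomp Require Import measurable_realfun complex ring lra.

(* Rotating the vector part commutes with z^q (because |sigma v| = |v|) and with
   the Fourier transform, so 1 (x) sigma maps a B-spline of q to a B-spline of
   (1 (x) sigma)(q); since sigma is invertible, one exists iff the other does.
   What remains is that a continuous integrable function h is determined by its
   Fourier transform. If all the integrals of h(x) cos(xi x + b) vanish, then so
   do those of h(x) cos(a (x - c) / m)^(m^2), and the limit m -> oo (dominated
   convergence) makes h orthogonal to all Gaussians; concentrating the Gaussian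
   at c forces h(c) = 0. *)

Import Order.TTheory GRing.Theory Num.Theory.
Import numFieldNormedType.Exports.

Local Open Scope classical_set_scope.
Local Open Scope ring_scope.

(** * Taylor bounds for the cosine and the limit of its powers *)

Section CosineBounds.
Context {R : realType}.
Implicit Types (f df : R -> R) (x y u t : R).

(** Tool for the four Taylor bounds that follow: the derivative of each remainder is the preceding
    remainder, up to sign, so each bound on sine or cosine yields the next. *)
Lemma ge0_of_derive_ge0 f df : (forall x, is_derive x 1 f (df x)) ->
  f 0 = 0 -> (forall x, 0 < x -> 0 <= df x) -> forall x, 0 <= x -> 0 <= f x.
Proof.
move=> fdf f0 df0 x x0; rewrite -f0.
apply: (@ger0_derive1_ndecry _ f 0) => //.
- by move=> y; rewrite in_itv/= andbT derive1E derive_val => /df0.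
- by apply: continuous_subspaceT => y; apply/differentiable_continuous/derivable1_diffP.
Qed.

Lemma sin_le_id x : 0 <= x -> sin x <= x.
Proof.
move=> x0; rewrite -subr_ge0.
apply: (@ge0_of_derive_ge0 (fun x => x - sin x) (fun x => 1 - cos x)) => //.
- by rewrite sin0 subr0.
Qed.

Lemma cos_ge_taylor2 x : 0 <= x -> 1 - x ^+ 2 / 2 <= cos x.
Proof.
move=> x0; rewrite -subr_ge0.
apply: (@ge0_of_derive_ge0 (fun x => cos x - (1 - x ^+ 2 / 2))
  (fun x => x - sin x)) => //.
- move=> y; apply: is_derive_eq; rewrite /GRing.scale/=; by field.
- by rewrite cos0 expr0n/= mul0r subr0 subrr.
- by move=> y /ltW; rewrite subr_ge0; exact: sin_le_id.
Qed.

Lemma sin_ge_taylor3 x : 0 <= x -> x - x ^+ 3 / 6 <= sin x.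
Proof.
move=> x0; rewrite -subr_ge0.
apply: (@ge0_of_derive_ge0 (fun x => sin x - (x - x ^+ 3 / 6))
  (fun x => cos x - (1 - x ^+ 2 / 2))) => //.
- move=> y; apply: is_derive_eq; rewrite /GRing.scale/=; by field.
- by rewrite sin0 expr0n/= mul0r !subr0.
- by move=> y /ltW; rewrite subr_ge0; exact: cos_ge_taylor2.
Qed.

Lemma cos_le_taylor4 x : 0 <= x -> cos x <= 1 - x ^+ 2 / 2 + x ^+ 4 / 24.
Proof.
move=> x0; rewrite -subr_ge0.
apply: (@ge0_of_derive_ge0 (fun x => 1 - x ^+ 2 / 2 + x ^+ 4 / 24 - cos x)
  (fun x => sin x - (x - x ^+ 3 / 6))) => //.
- move=> y; apply: is_derive_eq; rewrite /GRing.scale/=; by field.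
- by rewrite cos0 !expr0n/= !mul0r subr0 addr0 subrr.
- by move=> y /ltW; rewrite subr_ge0; exact: sin_ge_taylor3.
Qed.

(** Invert [1 + t <= expR t] and use (1 - t + t^2)(1 + t) = 1 + t^3 >= 1. *)
Lemma expRN_le_quadratic t : 0 <= t -> expR (- t) <= 1 - t + t ^+ 2.
Proof.
move=> t0; have t1 : 0 < 1 + t by lra.
rewrite expRN; apply: (@le_trans _ _ (1 + t)^-1).
  by rewrite lef_pV2 ?posrE ?expR_gt0// expR_ge1Dx.
rewrite -[leLHS]mul1r ler_pdivrMr//.
suff -> : (1 - t + t ^+ 2) * (1 + t) = 1 + t ^+ 3 by rewrite lerDl exprn_ge0.
by ring.
Qed.

(** The two functions have the same expansion up to order 2. For u >= 0 their difference lies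
    between -u^4/4 and u^4/24, and both sides are even in u. *)
Lemma cos_sub_gauss_le u : `|cos u - expR (- (u ^+ 2 / 2))| <= u ^+ 4.
Proof.
wlog u0 : u / 0 <= u.
  move=> H; have [/H//|/ltW u0] := leP 0 u.
  by have := H (- u); rewrite oppr_ge0 cosN sqrrN (@exprNn _ u 4) -signr_odd mul1r; exact.
have c2 := @cos_ge_taylor2 u u0; have c4 := @cos_le_taylor4 u u0.
have t0 : 0 <= u ^+ 2 / 2 by rewrite divr_ge0// sqr_ge0.
have e1 := @expR_ge1Dx R (- (u ^+ 2 / 2)).
have e2 := expRN_le_quadratic _ t0.
have u4 : 0 <= u ^+ 4 by exact: exprn_ge0.
have E : (u ^+ 2 / 2) ^+ 2 = u ^+ 4 / 4 by field.
rewrite E in e2; rewrite ler_norml; apply/andP; split; lra.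
Qed.

Lemma ler_norm_subXX x y n : `|x| <= 1 -> `|y| <= 1 ->
  `|x ^+ n - y ^+ n| <= n%:R * `|x - y|.
Proof.
move=> x1 y1; elim: n => [|n ih]; first by rewrite !expr0 subrr normr0 mul0r.
have -> : x ^+ n.+1 - y ^+ n.+1 = x * (x ^+ n - y ^+ n) + (x - y) * y ^+ n.
  by rewrite !exprS; ring.
rewrite (le_trans (ler_normD _ _))// -natr1 [leRHS]mulrDl mul1r !normrM lerD//.
  by rewrite (le_trans _ ih)// ler_piMl.
by rewrite ler_piMr// normrX exprn_ile1.
Qed.

(** With m = n + 1, the Gaussian at u is the m^2-th power of the Gaussian at u / m. Replacing the
    base by the cosine costs at most m^2 (u / m)^4 = u^4 / m^2, since both bases have modulus at
    most 1. *)
Lemma cvg_cosX_gauss u :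
  (fun n => cos (u / n.+1%:R) ^+ (n.+1 ^ 2)) @ \oo --> expR (- (u ^+ 2 / 2)).
Proof.
apply/cvgrPdist_le => e e0; near=> n.
have n0 : (0 : R) < n.+1%:R by [].
have -> : expR (- (u ^+ 2 / 2)) =
    expR (- ((u / n.+1%:R) ^+ 2 / 2)) ^+ (n.+1 ^ 2).
  rewrite -expRM_natl; congr expR; rewrite natrX; field.
  by rewrite gt_eqF.
rewrite distrC; apply: le_trans.
  apply: ler_norm_subXX; first exact: cos_max.
  by rewrite ger0_norm ?expR_ge0// expR_le1 oppr_le0 divr_ge0// sqr_ge0.
apply: le_trans; first by apply: ler_wpM2l (cos_sub_gauss_le _).
rewrite natrX.
have -> : n.+1%:R ^+ 2 * (u / n.+1%:R) ^+ 4 = u ^+ 4 / n.+1%:R ^+ 2 :> R.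
  by field; rewrite gt_eqF.
rewrite ler_pdivrMr ?exprn_gt0// mulrC -ler_pdivrMr//.
(* Bounding m^2 below by m gives the explicit threshold u^4 / e on n. *)
apply: (@le_trans _ _ n.+1%:R); last by rewrite ler_eXnr// ler1n.
near: n; exists (Num.trunc (u ^+ 4 / e)) => // n/= nt.
by rewrite ltW// (lt_le_trans (truncnS_gt _))// ler_nat ltnS.
Unshelve. all: by end_near. Qed.

End CosineBounds.

(** * Injectivity of the real cosine and sine transforms *)

Section CosineTransform.
Context {R : realType}.
Local Notation mu := (@lebesgue_measure R).
Local Notation integrable h := (mu.-integrable setT (EFin \o h)).
Implicit Types (h k w : R -> R) (a b c s x y xi : R).

Lemma integrable_mul_continuous h k : integrable h -> continuous k ->
  (forall x, `|k x| <= 1) -> integrable (fun x => h x * k x).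
Proof.
move=> ih ck k1; apply: (le_integrable measurableT _ _ ih) => //.
  apply/measurable_EFinP; apply: measurable_funM.
    by apply/measurable_EFinP; exact: measurable_int ih.
  exact: continuous_measurable_fun.
by move=> x _ /=; rewrite lee_fin normrM ler_piMr.
Qed.

Lemma continuous_cos_affine a b : continuous (fun x => cos (a * x + b)).
Proof.
move=> x; apply: (@continuous_comp _ _ _ (fun x => a * x + b));
  last exact: continuous_cos.
by apply: cvgD; [exact: mulrl_continuous|exact: cvg_cst].
Qed.

Lemma continuous_gauss s c :
  continuous (fun x => expR (- ((s * (x - c)) ^+ 2 / 2))).
Proof.
move=> x; apply: (@continuous_comp _ _ _ (fun x => - ((s * (x - c)) ^+ 2 / 2)));
  last exact: continuous_expR.
apply/differentiable_continuous/derivable1_diffP.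
exact: ex_derive.
Qed.

Lemma integrable_cos h a b : integrable h ->
  integrable (fun x => h x * cos (a * x + b)).
Proof.
move=> ih; apply: integrable_mul_continuous => // [|x].
  exact: continuous_cos_affine.
exact: cos_max.
Qed.

(** The free phase [b] covers cosine and sine in one condition, and makes the condition stable under
    multiplying [h] by a cosine. *)
Definition cos_orthogonal h :=
  forall xi b, \int[mu]_x (h x * cos (xi * x + b)) = 0.

(** The product-to-sum formula turns a product of two cosines into half the sum of cosines of
    frequencies a + xi and a - xi. *)
Lemma cos_orthogonal_mul_cos h a c : integrable h -> cos_orthogonal h ->
  cos_orthogonal (fun x => h x * cos (a * x + c)).
Proof.
move=> ih h0 xi b.
transitivity (\int[mu]_x ((h x * cos ((a + xi) * x + (c + b))) * 2^-1 +
                         (h x * cos ((a - xi) * x + (c - b))) * 2^-1)).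
  apply: eq_Rintegral => x _ /=.
  have -> : (a + xi) * x + (c + b) = (a * x + c) + (xi * x + b) by ring.
  have -> : (a - xi) * x + (c - b) = (a * x + c) - (xi * x + b) by ring.
  by move: (a * x + c) (xi * x + b) => u v; rewrite cosD cosB; field.
have i1 z t : integrable (fun x => h x * cos (z * x + t) * 2^-1).
  have : integrable (fun x => h x * cos (z * x + t)) by exact: integrable_cos.
  by move=> /(integrableZr _ 2^-1); exact.
rewrite RintegralD// !RintegralZr ?h0 ?mul0r ?addr0//; exact: integrable_cos.
Qed.

Lemma cos_orthogonal_mul_cosX h a c n : integrable h -> cos_orthogonal h ->
  integrable (fun x => h x * cos (a * x + c) ^+ n) /\
  cos_orthogonal (fun x => h x * cos (a * x + c) ^+ n).
Proof.
move=> ih h0; elim: n => [|n [ihn hn0]].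
  by split; under eq_fun do rewrite expr0 mulr1.
under eq_fun do rewrite exprSr mulrA; split; first exact: integrable_cos.
exact: cos_orthogonal_mul_cos.
Qed.

Lemma cos_orthogonal_gauss h s c : integrable h -> cos_orthogonal h ->
  integrable (fun x => h x * expR (- ((s * (x - c)) ^+ 2 / 2))) /\
  \int[mu]_x (h x * expR (- ((s * (x - c)) ^+ 2 / 2))) = 0.
Proof.
move=> ih h0; set g := fun x => _.
have ig : integrable g.
  apply: integrable_mul_continuous => // [|x]; first exact: continuous_gauss.
  by rewrite ger0_norm ?expR_ge0// expR_le1 oppr_le0 divr_ge0// sqr_ge0.
split=> //.
(* The phase centres the cosine at c: its argument is s (x - c) / (n + 1), so [cvg_cosX_gauss]
   applies pointwise, and |h| dominates every [u n]. *)
pose u n x := h x * cos (s / n.+1%:R * x + - (s / n.+1%:R * c)) ^+ (n.+1 ^ 2).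
have u0 n : integrable (u n) /\ \int[mu]_x u n x = 0.
  have [iu o] := cos_orthogonal_mul_cosX h
    (s / n.+1%:R) (- (s / n.+1%:R * c)) (n.+1 ^ 2) ih h0.
  (* At frequency and phase 0 the test cosine is 1, which leaves the plain integral of [u n]. *)
  split=> //; rewrite -[RHS](o 0 0).
  by apply: eq_Rintegral => x _; rewrite mul0r addr0 cos0 mulr1.
have cvg_EFin_u x : (EFin \o u n) x @[n --> \oo] --> (EFin \o g) x.
  apply: cvg_EFin; first exact: nearW.
  apply: cvgM; first exact: cvg_cst.
  have -> : (fun n => cos (s / n.+1%:R * x + - (s / n.+1%:R * c)) ^+ (n.+1 ^ 2)) =
      (fun n => cos ((s * (x - c)) / n.+1%:R) ^+ (n.+1 ^ 2)).
    by apply/funext => n; congr (cos _ ^+ _); ring.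
  exact: cvg_cosX_gauss.
have u_le n x : (`|(EFin \o u n) x| <= (EFin \o (fun x => `|h x|)%R) x)%E.
  by rewrite /= lee_fin normrM ler_piMr// normrX exprn_ile1// cos_max.
have [_ _] := @dominated_convergence _ _ _ mu setT measurableT
  (fun n => EFin \o u n) (EFin \o g) (EFin \o (fun x => `|h x|))
  (fun n => measurable_int mu (u0 n).1) (measurable_int mu ig)
  (aeW mu (fun x _ => cvg_EFin_u x)) (integrable_norm ih)
  (aeW mu (fun x n _ => u_le n x)).
rewrite (_ : [sequence _]_n = cst 0%E).
  by move=> /cvg_lim; rewrite /Rintegral lim_cst// => <-.
apply/funext => n /=; rewrite -[LHS]fineK ?integrable_fin_num ?(u0 n).1//.
by rewrite -/(Rintegral _ _ _) (u0 n).2.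
Qed.

(** If h(c) > 0, orthogonality to the Gaussians centred at c would bound a quantity linear in their
    sharpness s by the fixed L^1 norm of h. *)
Lemma cos_orthogonal_le0 h c : integrable h -> cos_orthogonal h ->
  {for c, continuous h} -> h c <= 0.
Proof.
move=> ih h0 hc; rewrite leNgt; apply/negP => hc0.
have hc2 : 0 < h c / 2 by rewrite divr_gt0.
have [d /= d0 hd] : exists2 d : R, 0 < d & forall x, `|x - c| < d -> h c / 2 <= h x.
  move/cvgrPdist_lt : hc => /(_ _ hc2) [d /= d0 hd]; exists d => // x xd.
  have := hd x; rewrite /ball_/= distrC => /(_ xd); rewrite ltr_distl => /andP[].
  by move=> _ ?; lra.
(* Lower bound for h times the Gaussian on its core |x - c| <= 1/s: there h >= h(c)/2 and the
   exponent is at least -1/2. *)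
set C := h c / 2 * expR (- (1 / 2)).
have C0 : 0 < C by rewrite mulr_gt0 ?expR_gt0.
pose N := \int[mu]_x `|h x|.
(* With K the Gaussian of width 1/s at c, I its core and E = exp(-(s d)^2/2) a
   bound for K away from c, one has C 1_I - E |h| <= h K; integrating gives
   2 C / s <= E N, and E <= 2 / (s d)^2. *)
have key s : d^-1 < s -> C * s * d ^+ 2 <= N.
  move=> sd; have s0 : 0 < s by rewrite (lt_trans _ sd)// invr_gt0.
  have [iK K0] := cos_orthogonal_gauss h s c ih h0.
  pose I : set R := [set` `[c - s^-1, c + s^-1]].
  set E := expR (- ((s * d) ^+ 2 / 2)).
  have iI : integrable (fun x => C * \1_I x).
    have := integrable_indic_itv (c - s^-1) (c + s^-1) true false.
    by move=> /(integrableZl measurableT C).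
  have iN : integrable (fun x => E * `|h x|).
    by have := integrable_norm ih => /(integrableZl measurableT E).
  have : \int[mu]_x (C * \1_I x - E * `|h x|) <= 0.
    rewrite -K0; apply: le_Rintegral => //.
      exact: (integrableB measurableT iI iN).
    move=> x _; set K := expR _.
    have K0' : 0 < K by exact: expR_gt0.
    have sxc : (s * (x - c)) ^+ 2 = (s * `|x - c|) ^+ 2.
      by rewrite !exprMn real_normK ?num_real.
    have sx0 : 0 <= s * `|x - c| by rewrite mulr_ge0// ltW.
    (* Three regions: on the core, h K >= C; elsewhere in |x - c| < d, h is still positive, so h K
       >= 0; beyond d, K <= E gives h K >= -E |h|. The hypothesis d^-1 < s puts the core inside |x -
       c| < d. *)
    have [xI|xI] := boolP (x \in I).
      have xc : `|x - c| <= s^-1.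
        by move: xI; rewrite inE /I/= in_itv/= ler_distl.
      have xd : `|x - c| < d by rewrite (le_lt_trans xc)// invf_plt ?posrE.
      rewrite indicE xI mulr1 (@le_trans _ _ C)//.
        by rewrite gerBl mulr_ge0// expR_ge0.
      apply: ler_pM; [exact: ltW|exact: expR_ge0|exact: hd|].
      rewrite ler_expR lerN2 ler_pM2r// sxc expr_le1//.
      by rewrite -ler_pdivlMl// mulr1.
    rewrite indicE (negbTE xI) mulr0 sub0r.
    have [xd|dx] := ltP `|x - c| d.
      rewrite (@le_trans _ _ 0)//; first by rewrite oppr_le0 mulr_ge0// expR_ge0.
      by rewrite mulr_ge0 ?expR_ge0// (le_trans (ltW hc2))// hd.
    have KE : K <= E.
      rewrite ler_expR lerN2 ler_pM2r// sxc lerXn2r// ?nnegrE//;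
        last by rewrite ler_pM2l.
      by rewrite mulr_ge0// ltW.
    rewrite lerNl -mulNr (le_trans (ler_norm _))// normrM normrN mulrC.
    by rewrite ler_wpM2r// gtr0_norm.
  rewrite RintegralB// !RintegralZl//;
    [|exact: integrable_norm|exact: integrable_indic_itv].
  have sV0 : 0 < s^-1 by rewrite invr_gt0.
  have muI : lebesgue_measure I = (c + s^-1 - (c - s^-1))%:E.
    by rewrite /I lebesgue_measure_itv/= lte_fin ifT//; lra.
  have -> : \int[mu]_x \1_I x = c + s^-1 - (c - s^-1).
    rewrite /Rintegral integral_indic; [|exact: measurableT|exact: measurable_itv].
    by rewrite (setIT I) [X in fine X]muI.
  rewrite -/N => CE.
  have N0 : 0 <= N by apply: Rintegral_ge0.
  have sd0 : 0 < (s * d) ^+ 2 by rewrite exprn_gt0// mulr_gt0.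
  have E2 : E <= 2 / (s * d) ^+ 2.
    rewrite /E expRN -[leRHS]invf_div lef_pV2 ?posrE ?expR_gt0 ?divr_gt0//.
    by rewrite (le_trans _ (expR_ge1Dx _))// lerDr.
  have : C * (c + s^-1 - (c - s^-1)) <= 2 / (s * d) ^+ 2 * N.
    by rewrite -subr_le0 (le_trans _ CE)// lerB// ler_wpM2r.
  have -> : C * s * d ^+ 2 = C * (c + s^-1 - (c - s^-1)) * ((s * d) ^+ 2 / 2).
    by field; rewrite gt_eqF.
  move=> /(ler_wpM2r (ltW (divr_gt0 sd0 (ltr0Sn R 1)))) /le_trans; apply.
  rewrite le_eqVlt; apply/orP; left; apply/eqP; field.
  by rewrite !gt_eqF.
have N0 : 0 <= N by apply: Rintegral_ge0.
have dV : 0 < d^-1 by rewrite invr_gt0.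
have Cd : 0 < C * d ^+ 2 by rewrite mulr_gt0// exprn_gt0.
(* This s exceeds d^-1 and makes C s d^2 equal to N plus the positive term C d^2 (d^-1 + 1),
   contradicting [key]. *)
have /key : d^-1 < N / (C * d ^+ 2) + (d^-1 + 1).
  by rewrite ltr_wpDl ?ltrDl// divr_ge0// ltW.
rewrite mulrAC mulrDr mulrC divfK ?gt_eqF//.
by rewrite gerDl leNgt mulr_gt0// addr_gt0.
Qed.

Lemma cos_orthogonal_eq0 h : continuous h -> integrable h ->
  cos_orthogonal h -> forall x, h x = 0.
Proof.
move=> ch ih h0 x; apply/le_anti/andP; split.
  by apply: cos_orthogonal_le0 => //; exact: ch.
rewrite -oppr_le0; apply: (cos_orthogonal_le0 (fun x => - h x)).
- exact: integrableN ih.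
- move=> xi b; rewrite -[RHS](mulr0 (-1)) -[in RHS](h0 xi b) -RintegralZl//.
    by apply: eq_Rintegral => y _; rewrite mulN1r mulNr.
  exact: integrable_cos.
- by apply: continuousN; exact: ch.
Qed.

Lemma integrable_sin h a : integrable h ->
  integrable (fun x => h x * sin (a * x)).
Proof.
move=> ih; apply: integrable_mul_continuous => // [x|x]; last exact: sin_max.
by apply: (@continuous_comp _ _ _ ( *%R a));
  [exact: mulrl_continuous|exact: continuous_sin].
Qed.

Lemma integrable_cos0 h a : integrable h ->
  integrable (fun x => h x * cos (a * x)).
Proof.
move=> /(integrable_cos h a 0) ih.
by apply: eq_integrable ih => // x _ /=; rewrite addr0.
Qed.

(** By the addition formula, the integral of (h - k)(x) cos(xi x + b) is a combination, with
    coefficients cos b and -sin b, of differences of the given transforms. Hence h - k is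
    [cos_orthogonal]. *)
Lemma trig_transform_inj h k : continuous h -> continuous k ->
  integrable h -> integrable k ->
  (forall xi, \int[mu]_x (h x * cos (xi * x)) = \int[mu]_x (k x * cos (xi * x))) ->
  (forall xi, \int[mu]_x (h x * sin (xi * x)) = \int[mu]_x (k x * sin (xi * x))) ->
  h =1 k.
Proof.
move=> ch ck ih ik hkc hks x; apply/eqP; rewrite -subr_eq0; apply/eqP.
apply: (cos_orthogonal_eq0 (fun x => h x - k x)).
- by move=> y; apply: continuousB; [exact: ch|exact: ck].
- exact: (integrableB measurableT ih ik).
move=> xi b.
have ic w : integrable w -> integrable (fun x => cos b * (w x * cos (xi * x))).
  by move=> /(integrable_cos0 _ xi) /(integrableZl measurableT (cos b)).
have isn w : integrable w -> integrable (fun x => sin b * (w x * sin (xi * x))).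
  by move=> /(integrable_sin _ xi) /(integrableZl measurableT (sin b)).
transitivity (\int[mu]_x
  ((cos b * (h x * cos (xi * x)) - cos b * (k x * cos (xi * x))) -
   (sin b * (h x * sin (xi * x)) - sin b * (k x * sin (xi * x))))).
  by apply: eq_Rintegral => y _; rewrite cosD; ring.
have iB u v : integrable u -> integrable v -> integrable (fun x => u x - v x).
  by move=> iu iv; exact: (integrableB measurableT iu iv).
rewrite !RintegralB//; [|by auto..].
rewrite !RintegralZl//; [|by [exact: integrable_cos0|exact: integrable_sin]..].
by rewrite hkc hks !subrr.
Qed.

End CosineTransform.

(** * Fourier transform of complex-valued functions *)

Section ComplexFourier.
Local Open Scope complex_scope.
Context {R : realType}.
Local Notation mu := (@lebesgue_measure R).
Local Notation integrable h := (mu.-integrable setT (EFin \o h)).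
Implicit Types (F G : R -> R[i]) (x xi : R).

Definition cintegrable F :=
  integrable (fun x => complex.Re (F x)) /\ integrable (fun x => complex.Im (F x)).

Definition ccontinuous F :=
  continuous (fun x => complex.Re (F x)) /\ continuous (fun x => complex.Im (F x)).

Definition cfourier F xi : R[i] :=
  cintegral (fun x => cexp (- ('i%C * xi%:C * x%:C)) * F x).

Lemma cexp_oppi xi x :
  cexp (- ('i%C * xi%:C * x%:C)) = cos (xi * x) +i* - sin (xi * x).
Proof.
have -> : - ('i%C * xi%:C * x%:C) = 0 +i* (- (xi * x)) :> R[i].
  by apply/eqP; rewrite eq_complex; apply/andP; split; apply/eqP => /=; ring.
by rewrite /cexp /= expR0 mul1r cosN sinN.
Qed.

Lemma cintegrable_cexp F xi : cintegrable F ->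
  cintegrable (fun x => cexp (- ('i%C * xi%:C * x%:C)) * F x).
Proof.
move=> [iRe iIm]; split.
- have := integrableD measurableT (integrable_cos0 _ xi iRe) (integrable_sin _ xi iIm).
  apply: eq_integrable => // x _; rewrite /comp cexp_oppi /=.
  by case: (F x) => a b /=; congr EFin; ring.
- have := integrableB measurableT (integrable_cos0 _ xi iIm) (integrable_sin _ xi iRe).
  apply: eq_integrable => // x _; rewrite /comp cexp_oppi /=.
  by case: (F x) => a b /=; congr EFin; ring.
Qed.

Lemma cfourierE F xi : cintegrable F ->
  cfourier F xi =
  (\int[mu]_x (complex.Re (F x) * cos (xi * x)) +
   \int[mu]_x (complex.Im (F x) * sin (xi * x))) +i*
  (\int[mu]_x (complex.Im (F x) * cos (xi * x)) -
   \int[mu]_x (complex.Re (F x) * sin (xi * x))).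
Proof.
move=> [iRe iIm]; rewrite -RintegralD -?RintegralB//;
  [|by [exact: integrable_cos0|exact: integrable_sin]..].
congr (_ +i* _); apply: eq_Rintegral => x _; rewrite cexp_oppi;
  by case: (F x) => a b /=; ring.
Qed.

(** At a single frequency the transform mixes the integrals of the real and imaginary parts.
    Comparing xi with -xi, where cosine integrals are kept and sine integrals change sign, separates
    the four of them. *)
Lemma cfourier_inj F G : ccontinuous F -> ccontinuous G ->
  cintegrable F -> cintegrable G -> cfourier F =1 cfourier G -> F =1 G.
Proof.
move=> [cRF cIF] [cRG cIG] iF iG FG.
have [iRF iIF] := iF; have [iRG iIG] := iG.
have cE h xi : \int[mu]_x (h x * cos (- xi * x)) = \int[mu]_x (h x * cos (xi * x)).
  by apply: eq_Rintegral => x _; rewrite mulNr cosN.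
have sE h xi : integrable h ->
    \int[mu]_x (h x * sin (- xi * x)) = - \int[mu]_x (h x * sin (xi * x)).
  move=> ih; rewrite -[RHS]mulN1r -RintegralZl//; last exact: integrable_sin.
  by apply: eq_Rintegral => x _; rewrite mulNr sinN; ring.
have key xi :
  (\int[mu]_x (complex.Re (F x) * cos (xi * x)) =
    \int[mu]_x (complex.Re (G x) * cos (xi * x)) /\
   \int[mu]_x (complex.Re (F x) * sin (xi * x)) =
    \int[mu]_x (complex.Re (G x) * sin (xi * x))) /\
  (\int[mu]_x (complex.Im (F x) * cos (xi * x)) =
    \int[mu]_x (complex.Im (G x) * cos (xi * x)) /\
   \int[mu]_x (complex.Im (F x) * sin (xi * x)) =
    \int[mu]_x (complex.Im (G x) * sin (xi * x))).
  have := FG (- xi); have := FG xi.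
  rewrite !cfourierE// !cE !sE// => -[e1 e2] [e3 e4].
  by split; split; lra.
move=> x; rewrite [F x]complexE [G x]complexE; congr (_%:C + _ * _%:C).
- by apply: (trig_transform_inj _ _ cRF cRG iRF iRG) => xi; have [[]] := key xi.
- by apply: (trig_transform_inj _ _ cIF cIG iIF iIG) => xi; have [_ []] := key xi.
Qed.

Lemma Re_sum (I : Type) (r : seq I) (z : I -> R[i]) :
  complex.Re (\sum_(i <- r) z i) = \sum_(i <- r) complex.Re (z i).
Proof.
elim: r => [|i r ih]; first by rewrite !big_nil.
by rewrite !big_cons -ih; case: (z i) (\sum_(_ <- r) _) => [a b] [].
Qed.

Lemma Im_sum (I : Type) (r : seq I) (z : I -> R[i]) :
  complex.Im (\sum_(i <- r) z i) = \sum_(i <- r) complex.Im (z i).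
Proof.
elim: r => [|i r ih]; first by rewrite !big_nil.
by rewrite !big_cons -ih; case: (z i) (\sum_(_ <- r) _) => [a b] [].
Qed.

Lemma Re_mulCl (c : R) (z : R[i]) : complex.Re (c%:C * z) = c * complex.Re z.
Proof. by case: z => a b /=; rewrite mul0r subr0. Qed.

Lemma Im_mulCl (c : R) (z : R[i]) : complex.Im (c%:C * z) = c * complex.Im z.
Proof. by case: z => a b /=; rewrite mul0r addr0. Qed.

Lemma Rintegral_sum (I : Type) (r : seq I) (h : I -> R -> R) :
  (forall i, integrable (h i)) ->
  \int[mu]_x (\sum_(i <- r) h i x) = \sum_(i <- r) \int[mu]_x h i x.
Proof.
move=> ih.
(* The induction also carries integrability of the partial sum, which additivity of the integral
   requires. *)
have [//] : integrable (fun x => \sum_(i <- r) h i x) /\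
  \int[mu]_x (\sum_(i <- r) h i x) = \sum_(i <- r) \int[mu]_x h i x.
elim: r => [|i r [ir rE]].
  rewrite (_ : (fun x => _) = cst 0); last by apply/funext => x; rewrite big_nil.
  by rewrite big_nil Rintegral_cst// mul0r; split=> //; exact: integrable0.
rewrite (_ : (fun x => _) = (fun x => h i x + \sum_(j <- r) h j x)).
  split; first exact: (integrableD measurableT (ih i) ir).
  by rewrite big_cons RintegralD// rE.
by apply/funext => x; rewrite big_cons.
Qed.

(** The coefficients are real, as the entries of the rotation are, so real and imaginary parts are
    integrated separately. *)
Lemma cintegral_sum (I : Type) (r : seq I) (c : I -> R) (F : I -> R -> R[i]) :
  (forall i, cintegrable (F i)) ->
  cintegral (fun x => \sum_(i <- r) (c i)%:C * F i x) =
  \sum_(i <- r) (c i)%:C * cintegral (F i).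
Proof.
move=> iF; apply/eqP; rewrite eq_complex Re_sum Im_sum [complex.Re (cintegral _)]/=
  [complex.Im (cintegral _)]/=.
apply/andP; split; apply/eqP.
- under eq_Rintegral do rewrite Re_sum.
  rewrite Rintegral_sum => [|i].
    by apply: eq_bigr => i _; rewrite Re_mulCl [RHS]/= -RintegralZl//;
      [apply: eq_Rintegral => x _; rewrite Re_mulCl|exact: (iF i).1].
  under eq_fun do rewrite Re_mulCl.
  exact: (integrableZl measurableT (c i) (iF i).1).
- under eq_Rintegral do rewrite Im_sum.
  rewrite Rintegral_sum => [|i].
    by apply: eq_bigr => i _; rewrite Im_mulCl [RHS]/= -RintegralZl//;
      [apply: eq_Rintegral => x _; rewrite Im_mulCl|exact: (iF i).2].
  under eq_fun do rewrite Im_mulCl.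
  exact: (integrableZl measurableT (c i) (iF i).2).
Qed.

End ComplexFourier.

(** * Rotation of B-splines *)

Section Bspline.
Local Open Scope complex_scope.
Context {R : realType}.
Implicit Types (s : 'M[R]_3) (q : quat R) (f g : R -> quat R[i]).

Lemma fourierE f xi : fourier f xi =
  (cfourier (fun x => Sc (f x)) xi,
   \col_j cfourier (fun x => Vec (f x) j ord0) xi).
Proof.
rewrite /fourier /qintegral; congr pair; apply/colP => j; rewrite !mxE.
by congr cintegral; apply/funext => x; rewrite /Vec /= mxE.
Qed.

(** Injectivity of the Fourier transform in each complex coordinate. This makes the function chosen
    by [Bspline] independent of the choice. *)
Lemma is_Bspline_unique q f g : is_Bspline q f -> is_Bspline q g -> f =1 g.
Proof.
move=> [[cf1 cf2 cf3 cf4] [if1 if2 if3 if4] fq].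
move=> [[cg1 cg2 cg3 cg4] [ig1 ig2 ig3 ig4] gq].
have E xi : fourier f xi = fourier g xi by rewrite fq gq.
have ScE : (fun x => Sc (f x)) =1 (fun x => Sc (g x)).
  by apply: cfourier_inj; [by []..|move=> xi];
    have := E xi; rewrite !fourierE => /(congr1 fst).
have VecE j : (fun x => Vec (f x) j ord0) =1 (fun x => Vec (g x) j ord0).
  apply: cfourier_inj; [by split; auto..|move=> xi].
  have := E xi; rewrite !fourierE => /(congr1 snd)/=.
  by move=> /colP/(_ j); rewrite !mxE.
move=> x; have := ScE x; have : Vec (f x) = Vec (g x).
  by apply/colP => j; exact: VecE.
by case: (f x) (g x) => [a u] [b v]; rewrite /Sc /Vec/= => -> ->.
Qed.

(** Stated for any [P] stable under real linear combinations, so as to serve both continuity and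
    integrability. As [s] is real, each real coordinate of the image combines coordinates of the
    same kind, real or imaginary. *)
Lemma coordwise_qrotC (P : (R -> R) -> Prop) s f :
  P (cst 0) -> (forall h k, P h -> P k -> P (fun x => h x + k x)) ->
  (forall c h, P h -> P (fun x => c * h x)) ->
  coordwise P f -> coordwise P (fun x => qrotC s (f x)).
Proof.
move=> P0 PD PZ [f1 f2 f3 f4].
have PS (c : 'I_3 -> R) (h : 'I_3 -> R -> R) : (forall j, P (h j)) ->
    P (fun x => \sum_j c j * h j x).
  move=> Ph; elim: (index_enum _) => [|j r ihr].
    by under eq_fun do rewrite big_nil.
  by under eq_fun do rewrite big_cons; exact/PD/ihr/PZ.
split=> // j.
- rewrite (_ : (fun x => _) = fun x => \sum_k s j k * complex.Re (Vec (f x) k ord0)).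
    exact: PS.
  by apply/funext => x; rewrite /Vec/= mxE Re_sum;
    apply: eq_bigr => k _; rewrite mxE Re_mulCl.
- rewrite (_ : (fun x => _) = fun x => \sum_k s j k * complex.Im (Vec (f x) k ord0)).
    exact: PS.
  by apply/funext => x; rewrite /Vec/= mxE Im_sum;
    apply: eq_bigr => k _; rewrite mxE Im_mulCl.
Qed.

(** Each vector coordinate of the image is a finite real combination of integrable coordinates, so
    the matrix product passes through the integral. *)
Lemma fourier_qrotC s f xi : qintegrable f ->
  fourier (fun x => qrotC s (f x)) xi = qrotC s (fourier f xi).
Proof.
move=> [_ _ iRe iIm]; rewrite !fourierE; congr pair; apply/colP => j.
rewrite /Vec/= !mxE; under [RHS]eq_bigr do rewrite !mxE.
rewrite -cintegral_sum => [|k]; last first.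
  exact: (cintegrable_cexp _ _ (conj (iRe k) (iIm k))).
congr cintegral; apply/funext => x; rewrite mxE mulr_sumr.
by apply: eq_bigr => k _; rewrite mxE mulrCA.
Qed.

Lemma vnorm_mul s (v : 'cV[R]_3) : s^T *m s = 1%:M -> vnorm (s *m v) = vnorm v.
Proof.
have E (w : 'cV[R]_3) : \sum_(j < 3) w j ord0 ^+ 2 = (w^T *m w) ord0 ord0.
  by rewrite mxE; apply: eq_bigr => j _; rewrite mxE expr2.
by move=> ss; rewrite /vnorm !E trmx_mul mulmxA -(mulmxA v^T) ss mulmx1.
Qed.

Lemma qpow_qrot s z q : s^T *m s = 1%:M ->
  qpow z (qrot s q) = qrotC s (qpow z q).
Proof.
move=> ss; rewrite /qpow; case: ifPn => _.
  by rewrite /qrotC /qrot /= mulmx0.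
rewrite /qrotC /qrot /qscale /Sc /Vec /= vnorm_mul//; congr pair.
by rewrite -!scalemxAr -map_mxM -scalemxAr.
Qed.

Lemma is_Bspline_qrot s q f : s^T *m s = 1%:M -> is_Bspline q f ->
  is_Bspline (qrot s q) (fun x => qrotC s (f x)).
Proof.
move=> ss [cf intf fq]; split.
- apply: coordwise_qrotC cf => [|h k ch ck|c h ch] x.
  + exact: cvg_cst.
  + by apply: cvgD; [exact: ch|exact: ck].
  + by apply: cvgM; [exact: cvg_cst|exact: ch].
- apply: coordwise_qrotC intf => [|h k ih ik|c h ih].
  + exact: integrable0.
  + exact: (integrableD measurableT ih ik).
  + exact: (integrableZl measurableT c ih).
- by move=> xi; rewrite fourier_qrotC// fq qpow_qrot.
Qed.

Lemma qrotK s : s^T *m s = 1%:M -> cancel (qrot s) (qrot s^T).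
Proof.
by move=> ss [a v]; rewrite /qrot /Sc /Vec/= mulmxA ss mul1mx.
Qed.

End Bspline.

Theorem lemma5 (R : realType) (s : 'M[R]_3) :
  SO3 s ->
  forall q : quat R, 1 < Sc q ->
  forall t : R, Bspline (qrot s q) t = qrotC s (Bspline q t).
Proof.
move=> [ss _] q _ t.
have ss' : s^T^T *m s^T = 1%:M by rewrite trmxK; exact: mulmx1C.
(* Classical case split on existence. If a B-spline of [q] exists, its rotation and the chosen
   function for the rotated quaternion are both B-splines of the latter, hence equal. *)
have [[f fq]|nex] := pselect (exists f, is_Bspline q f).
  have Bq : is_Bspline q (Bspline q) by exact: (xgetPex _ (ex_intro _ f fq)).
  have Bsq := is_Bspline_qrot _ _ _ ss Bq.
  have BsqE : is_Bspline (qrot s q) (Bspline (qrot s q)).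
    exact: (xgetPex _ (ex_intro _ _ Bsq)).
  exact: (is_Bspline_unique _ _ _ BsqE Bsq).
(* Otherwise the rotated quaternion has no B-spline either, since [s^T] would carry one back to [q].
   Both choices then take the default value 0, which the rotation fixes. *)
rewrite /Bspline !xgetPN => [|g gq|g gq]; last 2 first.
- by apply: nex; exists g.
- apply: nex; exists (fun x => qrotC s^T (g x)).
  by rewrite -(qrotK _ ss q); exact: is_Bspline_qrot.
by rewrite /qrotC /qrot /= mulmx0.
Qed.
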